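(* Let $K$ be a field, let $n\ge3$, let $M$ be the Chinese monoid of rank $n$, and let $D$ be the tree of diagrams for $n$, with associated congruences on $M$. If $\rho=\rho(d)$ and $\rho'=\rho(d')$ are the congruences corresponding to diagrams $d,d'\in D$, and $d,d'$ are in different branches of $D$ (i.e. neither of $d,d'$ lies on the chain of vertices leading from the root to the other), then $\mathcal{I}_\rho\nsubseteq\mathcal{I}_{\rho'}$.
   Context: The Chinese monoid of rank $n$ is the monoid $M=\langle a_1,\dots,a_n\rangle$ defined by the relations $a_ja_ia_k=a_ja_ka_i=a_ka_ja_i$ for $i\le k\le j$; $K[M]$ is its monoid algebra. For a congruence $\eta$ on $M$, $\mathcal{I}_\eta$ is the ideal of $K[M]$ spanned over $K$ by $\{s-t: (s,t)\in\eta\}$. **The tree $D$.** A diagram is a collection of dots (a dot $a_s$ uses the single index $s$) and arcs (an arc $a_ya_x$, $x<y$, uses the two indices $x,y$) on $\{1,\dots,n\}$, each index being used at most once. The vertices of the finite tree $D$ are the following diagrams, built level by level. The root (level 0) is the empty diagram. The children of the root (level 1) are the $n-2$ single dots $a_s$, $s=2,\dots,n-1$, and the $n-1$ single arcs $a_sa_{s-1}$, $s=2,\dots,n$. In each non-root vertex the used indices form an interval $\{u,u+1,\dots,v\}$. A non-root vertex is a leaf (it has no children) if it contains an arc using index $1$ or index $n$. If a non-root vertex $d$ with used interval $\{u,\dots,v\}$ is not a leaf (then $1<u\le v<n$), its children are: (i) the diagram obtained by adding the arc $a_{v+1}a_{u-1}$; (ii) if the last step in the construction of $d$ was adding an arc: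 the diagram obtained by adding the dot $a_{v+1}$ (provided $v+1<n$) and the diagram obtained by adding the dot $a_{u-1}$ (provided $u-1>1$); (iii) if $d$ is in level $\ge 2$ and the last step was adding a dot: if that dot was $a_v$, the diagram obtained by adding the dot $a_{v+1}$ (provided $v+1<n$); if that dot was $a_u$, the diagram obtained by adding the dot $a_{u-1}$ (provided $u-1>1$). (If $d$ is a single dot in level 1, its only child is the one in (i).) **The congruences $\rho(d)$.** Let $B=\langle p,q: qp=1\rangle$ be the bicyclic monoid, let $\mathbb{N}$ (nonnegative integers under addition) be written multiplicatively as $\langle g\rangle$, and $\mathbb{Z}$ as $\langle g,g^{-1}\rangle$. For an interval $\{u,\dots,v\}$ let $C_{u,v}$ be the monoid generated by the $a_i$ with $i<u$ or $i>v$, subject to the Chinese relations among these generators and the additional relations that $a_1,\dots,a_{u-1}$ commute with each other and $a_{v+1},\dots,a_n$ commute with each other (it is trivial if there are no generators). Let $d\in D$ be in level $r$, with branch $d_0$ (root), $d_1,\dots,d_r=d$ leading from the root to $d$. Put $C_0=M$, $S_0=\{1\}$, and for $t\ge1$ let $C_t=C_{u,v}$, where $\{u,\dots,v\}$ is the set of used indices of $d_t$. For $0\le t<r$: - if $d_{t+1}$ arises from $d_t$ by adding a dot $a_s$, put $S_{t+1}=\mathbb{N}\times S_t$ and let $\psi_t: C_t\to C_{t+1}\times \mathbb{N}$ be the homomorphism with $a_s\mapsto(1,g)$ and $a_l\mapsto(a_l,1)$ for $l\ne s$; - if $d_{t+1}$ arises from $d_t$ by adding an arc $a_ya_x$ ($x<y$),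 put $S_{t+1}=B\times\mathbb{Z}\times S_t$ and let $\psi_t:C_t\to C_{t+1}\times B\times\mathbb{Z}$ be the homomorphism with $a_x\mapsto(1,p,g)$, $a_y\mapsto(1,q,1)$, $a_l\mapsto(a_l,p,1)$ for $l<x$, $a_l\mapsto(a_l,q,1)$ for $l>y$. Let $\kappa_t=\psi_t\times \mathrm{id}: C_t\times S_t\to C_{t+1}\times S_{t+1}$. Then $\rho(\text{root})$ is the trivial congruence on $M$ and, for $r\ge1$, $\rho(d)$ is the kernel congruence of $\kappa_{r-1}\circ\dots\circ\kappa_0: M\to C_r\times S_r$. *)

(* Defs.v *)
From HB Require Import structures.
From mathcomp Require Import all_boot all_order all_algebra.
From mathcomp Require Import zify.
From mathcomp Require Import boolp.
From mathcomp Require Import monalg.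

Set Implicit Arguments.
Unset Strict Implicit.
Unset Printing Implicit Defensive.

Local Open Scope quotient_scope.
Local Open Scope group_scope.

Section Presentation.
Variables (G : choiceType) (R : seq G -> seq G -> Prop).

Inductive cong : seq G -> seq G -> Prop :=
| cong_rel u v : R u v -> cong u v
| cong_refl u : cong u u
| cong_sym u v : cong u v -> cong v u
| cong_trans v u w : cong u v -> cong v w -> cong u w
| cong_cat u u' v v' : cong u u' -> cong v v' -> cong (u ++ v) (u' ++ v').

Definition congb : rel (seq G) := fun u v => `[< cong u v >].

Lemma congb_refl : reflexive congb.
Proof. by move=> u; apply/asboolP; exact: cong_refl. Qed.

Lemma congb_sym : symmetric congb.
Proof. by move=> u v; apply/asboolP/asboolP; exact: cong_sym. Qed.

Lemma congb_trans : transitive congb.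
Proof.
move=> v u w /asboolP uv /asboolP vw; apply/asboolP.
exact: cong_trans uv vw.
Qed.

Canonical cong_equiv := EquivRel congb congb_refl congb_sym congb_trans.

(* The monoid < G | R >, as the quotient of the words on G. *)
Definition presented := {eq_quot cong_equiv}.
HB.instance Definition _ := Choice.on presented.
HB.instance Definition _ := Quotient.on presented.

Lemma presentedP u v : \pi_presented u = \pi_presented v <-> cong u v.
Proof.
by split=> [/eqmodP /asboolP|uv] //; apply/eqmodP/asboolP.
Qed.

Definition pmul (x y : presented) : presented := \pi_presented (repr x ++ repr y).

Lemma pmul_pi u v : pmul (\pi u) (\pi v) = \pi_presented (u ++ v).
Proof. by apply/presentedP; apply: cong_cat; apply/presentedP; rewrite reprK. Qed.

Lemma pmulA : associative pmul.
Proof.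
by move=> x y z; rewrite -[x]reprK -[y]reprK -[z]reprK !pmul_pi catA.
Qed.

Lemma pmul1x : left_id (\pi_presented [::]) pmul.
Proof. by move=> x; rewrite -[x]reprK pmul_pi. Qed.

Lemma pmulx1 : right_id (\pi_presented [::]) pmul.
Proof. by move=> x; rewrite -[x]reprK pmul_pi cats0. Qed.

HB.instance Definition _ := isMonoid.Build presented pmulA pmul1x pmulx1.

Definition gen (a : G) : presented := \pi_presented [:: a].

(* The homomorphism determined by a map f on the generators.  Evaluating it on
   a representative word is meaningful only if f respects the relations, cf.
   lift_hom_morphism; for the maps used here, cf. psi_morphism. *)
Definition lift_hom (N : monoidType) (f : G -> N) (w : presented) : N :=
  \prod_(a <- repr w) f a.

Definition respects (N : monoidType) (f : G -> N) :=
  forall u v, R u v -> \prod_(a <- u) f a = \prod_(a <- v) f a.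

Lemma lift_hom_pi (N : monoidType) (f : G -> N) : respects f ->
  forall u, lift_hom f (\pi u) = \prod_(a <- u) f a.
Proof.
move=> fR u; rewrite /lift_hom.
have : cong (repr (\pi_presented u)) u by apply/presentedP; rewrite reprK.
move: (repr _) => w; elim=> {w u} //.
- by move=> v u w _ -> _ ->.
- by move=> u u' v v' _ e _ e'; rewrite !big_cat e e'.
Qed.

Lemma lift_hom_morphism (N : monoidType) (f : G -> N) : respects f ->
  monoid_morphism (lift_hom f) /\ forall a, lift_hom f (gen a) = f a.
Proof.
move=> fR; split=> [|a]; last by rewrite lift_hom_pi // big_seq1.
split=> [|x y]; first by rewrite lift_hom_pi // big_nil.
by rewrite -[x]reprK -[y]reprK [_ * _]pmul_pi !lift_hom_pi // big_cat.
Qed.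

End Presentation.

Lemma gen_rel (G : choiceType) (R : seq G -> seq G -> Prop) u v : R u v ->
  \prod_(a <- u) gen R a = \prod_(a <- v) gen R a.
Proof.
move=> uv; have piE w : \prod_(a <- w) gen R a = \pi_(presented R) w.
  by elim: w => [|a w ih]; rewrite ?big_nil // big_cons ih [_ * _]pmul_pi.
by rewrite !piE; apply/presentedP/cong_rel.
Qed.

Definition pB := true.
Definition qB := false.
Definition bicyclic : monoidType :=
  presented (fun u v : seq bool => u = [:: qB; pB] /\ v = [::]).

(* <g> and <g, g^-1>: the element k stands for g^k. *)
Definition Nmul : Type := nat.
HB.instance Definition _ := Choice.on Nmul.
HB.instance Definition _ := isMonoid.Build Nmul addnA add0n addn0.

Definition Zmul : Type := int.
HB.instance Definition _ := Choice.on Zmul.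
HB.instance Definition _ := isMonoid.Build Zmul
  (@GRing.addrA int) (@GRing.add0r int) (@GRing.addr0 int).

Definition unitM (x y : unit) : unit := tt.
Lemma unitMA : associative unitM. Proof. by []. Qed.
Lemma unitM1x : left_id tt unitM. Proof. by case. Qed.
Lemma unitMx1 : right_id tt unitM. Proof. by case. Qed.
HB.instance Definition _ := isMonoid.Build unit unitMA unitM1x unitMx1.

(* A set of used indices, being an interval, is represented by its end points;
   None is the empty set. *)
Definition used_in (I : option (nat * nat)) (i : nat) : bool :=
  if I is Some (u, v) then u <= i <= v else false.

Definition letter (n : nat) (I : option (nat * nat)) : choiceType :=
  {i : nat | (0 < i <= n) && ~~ used_in I i}.

Inductive C_rel (n : nat) (I : option (nat * nat)) :
    seq (letter n I) -> seq (letter n I) -> Prop :=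
| chinese_l i k j : val i <= val k <= val j -> C_rel [:: j; i; k] [:: j; k; i]
| chinese_r i k j : val i <= val k <= val j -> C_rel [:: j; k; i] [:: k; j; i]
| comm_low u v i k : I = Some (u, v) -> val i < u -> val k < u ->
    C_rel [:: i; k] [:: k; i]
| comm_high u v i k : I = Some (u, v) -> v < val i -> v < val k ->
    C_rel [:: i; k] [:: k; i].

(* C n (Some (u, v)) is C_{u,v}; the commutation relations are void in
   C n None, which is the Chinese monoid. *)
Definition C n I := presented (@C_rel n I).
HB.instance Definition _ n I := Monoid.on (C n I).
HB.instance Definition _ n I := Quotient.on (C n I).

Definition chinese_monoid (n : nat) := C n None.
HB.instance Definition _ n := Monoid.on (chinese_monoid n).

Lemma C_unit n I (x y : C n I) : x * y = 1 -> x = 1 /\ y = 1.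
Proof.
have resp : respects (@C_rel n I) (fun=> 1%N : Nmul).
  by move=> u v [] *; rewrite !big_cons.
have [[l1 lM] _] := lift_hom_morphism resp; set l := lift_hom _ in l1 lM.
have l0 z : l z = 1 -> z = 1.
  rewrite -[z]reprK /l lift_hom_pi //; case: (repr z) => // a s.
  by rewrite big_cons.
move=> xy; have : l x * l y = 1 by rewrite -lM xy.
by move/eqP; rewrite [_ * _]/(addn _ _) addn_eq0 => /andP[/eqP/l0 -> /eqP/l0 ->].
Qed.

(* monalg puts the ring structure of a monoid algebra {malg K[T]} on the
   types T of this structure. *)
HB.instance Definition _ n := Choice_isMonomialDef.Build (chinese_monoid n)
  (@mulgA (chinese_monoid n)) (@mul1g (chinese_monoid n)) (@mulg1 (chinese_monoid n))
  (@C_unit n None).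

Definition component : Type := nat + nat * nat.
HB.instance Definition _ := Choice.on component.
Definition Dot (s : nat) : component := inl s.
Definition Arc (y x : nat) : component := inr (y, x).

(* A vertex of D is recorded together with its construction: the components of
   the diagram, the last one added first.  Its branch thus consists of the
   suffixes of the sequence, the root being [::]. *)
Definition diagram := seq component.

Definition indices (c : component) : seq nat :=
  match c with inl s => [:: s] | inr (y, x) => [:: x; y] end.

Definition used (d : diagram) : seq nat := flatten (map indices d).

Definition used_span (d : diagram) : option (nat * nat) :=
  if used d is i :: s then Some (foldr minn i s, foldr maxn i s) else None.

Definition is_arc (c : component) : bool := if c is inr _ then true else false.

Definition is_leaf (n : nat) (d : diagram) : bool :=
  has (fun c => is_arc c && ((1%N \in indices c) || (n \in indices c))) d.

(* The components whose addition to the vertex d gives the children of d. *)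
Definition steps (n : nat) (d : diagram) : seq component :=
  if used_span d is Some (u, v) then
    if is_leaf n d then [::] else
    let dotr := if v.+1 < n then [:: Dot v.+1] else [::] in
    let dotl := if 1 < u.-1 then [:: Dot u.-1] else [::] in
    Arc v.+1 u.-1 ::
    match d with
    | inr _ :: _ => dotr ++ dotl
    | inl s :: _ :: _ => (if s == v then dotr else [::])
                         ++ (if s == u then dotl else [::])
    | _ => [::]
    end
  else [seq Dot s | s <- index_iota 2 n]
       ++ [seq Arc s s.-1 | s <- index_iota 2 n.+1].

Fixpoint D (n : nat) (d : diagram) : bool :=
  if d is c :: d' then D n d' && (c \in steps n d') else true.

Definition different_branches (d d' : diagram) : bool :=
  ~~ suffix d d' && ~~ suffix d' d.

Definition factor (c : component) : monoidType :=
  if c is inl _ then Nmul else (bicyclic * Zmul)%type.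

Fixpoint Sfac (d : diagram) : monoidType :=
  if d is c :: d' then (factor c * Sfac d')%type else unit.

(* a_l if l is still a generator, and 1 otherwise. *)
Definition retract n I J (l : letter n I) : C n J :=
  if insub (val l) is Some l' then gen _ l' else 1.

(* No generator a_l with x < l < y is left when the arc a_y a_x is added. *)
Definition psi_gen (n : nat) (d : diagram) (c : component) (l : letter n (used_span d)) :
    (C n (used_span (c :: d)) * factor c)%type :=
  (retract (used_span (c :: d)) l,
   match c return factor c with
   | inl s => nat_of_bool (val l == s)
   | inr (y, x) => (gen _ (if val l <= x then pB else qB), Posz (val l == x))
   end).

Definition psi (n : nat) (d : diagram) (c : component) :
    C n (used_span d) -> (C n (used_span (c :: d)) * factor c)%type :=
  lift_hom (@psi_gen n d c).

Lemma foldr_minn a b s : foldr minn a (b :: s) = minn a (foldr minn b s).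
Proof. by elim: s => /= [|c s]; lia. Qed.

Lemma foldr_maxn a b s : foldr maxn a (b :: s) = maxn a (foldr maxn b s).
Proof. by elim: s => /= [|c s]; lia. Qed.

Lemma used_span_le d u v : used_span d = Some (u, v) -> u <= v.
Proof.
rewrite /used_span; case: (used d) => // i s [<- <-].
by elim: s => //= j s; lia.
Qed.

Lemma used_span_cons c d : exists u v, used_span (c :: d) = Some (u, v) /\
  forall u' v', used_span d = Some (u', v') -> u <= u' /\ v' <= v.
Proof.
rewrite /used_span /used; case: c => [s|[y x]] /=; do 2! eexists;
  (split; first by []) => u' v'; case: (flatten _) => // i s' [<- <-];
  rewrite ?(foldr_minn s) ?(foldr_maxn s) ?(foldr_minn x) ?(foldr_maxn x);
  lia.
Qed.

Lemma retract_respects n c d :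
  respects (@C_rel n (used_span d)) (@retract n _ (used_span (c :: d))).
Proof.
have [u [v [eJ sub]]] := used_span_cons c d; rewrite eJ.
set I := used_span d in sub *; set J := Some (u, v); set f := @retract n I J.
have f1 l : u <= val l <= v -> f l = 1.
  by move=> h; rewrite /f /retract insubF //= h andbF.
have fE l : ~~ (u <= val l <= v) ->
    exists2 l' : letter n J, val l' = val l & f l = gen _ l'.
  move=> h; rewrite /f /retract; case: insubP => [l' _ <-|]; first by exists l'.
  by rewrite /= h andbT; case: l h => /= l /andP[->].
have fC l m : (val l <= v) && (val m <= v) || (u <= val l) && (u <= val m) ->
    f l * f m = f m * f l.
  move=> h; have [/f1 ->|lJ] := boolP (u <= val l <= v).
    by rewrite mulg1 mul1g.
  have [/f1 ->|mJ] := boolP (u <= val m <= v); first by rewrite mulg1 mul1g.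
  have [l' el ->] := fE l lJ; have [m' em ->] := fE m mJ.
  have : @C_rel n J [:: l'; m'] [:: m'; l'].
    have [h'|h'] : (val l' < u /\ val m' < u) \/ (v < val l' /\ v < val m').
      by lia.
    - by apply: (comm_low (erefl J)); case: h'.
    - by apply: (comm_high (erefl J)); case: h'.
  by move/gen_rel; rewrite !big_cons !big_nil !mulg1.
move=> w w' [].
- move=> i k j h; rewrite !big_cons !big_nil !mulg1.
  have [/f1 ->|kJ] := boolP (u <= val k <= v); first by rewrite mulg1 mul1g.
  have [hC|hC] := boolP ((val i <= v) && (val k <= v) ||
                         (u <= val i) && (u <= val k)).
    by rewrite (fC i k).
  have [i' ei ->] : exists2 i' : letter n J, val i' = val i & f i = gen _ i'.
    by apply: fE; lia.
  have [j' ej ->] : exists2 j' : letter n J, val j' = val j & f j = gen _ j'.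
    by apply: fE; lia.
  have [k' ek ->] := fE k kJ.
  have : @C_rel n J [:: j'; i'; k'] [:: j'; k'; i'].
    by apply: chinese_l; rewrite ei ej ek.
  by move/gen_rel; rewrite !big_cons !big_nil !mulg1.
- move=> i k j h; rewrite !big_cons !big_nil !mulg1.
  have [/f1 ->|kJ] := boolP (u <= val k <= v); first by rewrite !mul1g.
  have [hC|hC] := boolP ((val j <= v) && (val k <= v) ||
                         (u <= val j) && (u <= val k)).
    by rewrite !mulgA (fC j k).
  have [i' ei ->] : exists2 i' : letter n J, val i' = val i & f i = gen _ i'.
    by apply: fE; lia.
  have [j' ej ->] : exists2 j' : letter n J, val j' = val j & f j = gen _ j'.
    by apply: fE; lia.
  have [k' ek ->] := fE k kJ.
  have : @C_rel n J [:: j'; k'; i'] [:: k'; j'; i'].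
    by apply: chinese_r; rewrite ei ej ek.
  by move/gen_rel; rewrite !big_cons !big_nil !mulg1.
- move=> u' v' i k e; have [] := sub _ _ e; have := used_span_le e.
  by move=> *; rewrite !big_cons !big_nil !mulg1; apply: fC; lia.
- move=> u' v' i k e; have [] := sub _ _ e; have := used_span_le e.
  by move=> *; rewrite !big_cons !big_nil !mulg1; apply: fC; lia.
Qed.

Lemma arc_respects n d y x : Arc y x \in steps n d ->
  respects (@C_rel n (used_span d))
    (fun l => gen _ (if val l <= x then pB else qB) : bicyclic).
Proof.
move=> cd; set p : bicyclic := gen _ pB; set q : bicyclic := gen _ qB.
have qp : q * p = 1.
  have := @gen_rel _ (fun u v : seq bool => u = [:: qB; pB] /\ v = [::]).
  move/(_ [:: qB; pB] [::]); rewrite !big_cons !big_nil mulg1; exact.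
have xE u v : used_span d = Some (u, v) -> x = u.-1.
  move=> e; move: cd; rewrite /steps e; case: ifP => // _.
  rewrite inE => /orP[/eqP[_ ->] //|]; case: d {e} => [|[s|[? ?]] [|c d]] //=;
  by rewrite mem_cat; do ![case: ifP => _]; rewrite ?inE.
set g := fun l : letter n _ => _.
have gp l : val l <= x -> g l = p by rewrite /g => ->.
have gq l : ~~ (val l <= x) -> g l = q by rewrite /g => /negbTE ->.
have qpM b : q * (p * b) = b by rewrite mulgA qp mul1g.
move=> w w' []; [move=> i k j h|move=> i k j h|move=> u v i k e hi hk|
                 move=> u v i k e hi hk]; rewrite !big_cons !big_nil !mulg1.
- have [hi|hi] := boolP (val i <= x); have [hk|hk] := boolP (val k <= x);
    have [hj|hj] := boolP (val j <= x); try lia;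
    by rewrite ?(gp _ hi) ?(gq _ hi) ?(gp _ hk) ?(gq _ hk) ?(gp _ hj)
      ?(gq _ hj) ?qpM ?qp ?mulg1.
- have [hi|hi] := boolP (val i <= x); have [hk|hk] := boolP (val k <= x);
    have [hj|hj] := boolP (val j <= x); try lia;
    by rewrite ?(gp _ hi) ?(gq _ hi) ?(gp _ hk) ?(gq _ hk) ?(gp _ hj)
      ?(gq _ hj) ?qpM ?qp ?mulg1.
- by have := xE _ _ e => ?; rewrite !gp //; lia.
- by have := used_span_le e; have := xE _ _ e => ? ?; rewrite !gq //; lia.
Qed.

Lemma psi_morphism (n : nat) (d : diagram) (c : component) : c \in steps n d ->
  monoid_morphism (@psi n d c) /\
  forall l, @psi n d c (gen _ l) = @psi_gen n d c l.
Proof.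
move=> cd; apply: lift_hom_morphism => w w' ww'.
have pairE (G H : monoidType) (g : letter n (used_span d) -> G) (h : _ -> H) s :
    \prod_(a <- s) ((g a, h a) : (G * H)%type) =
    (\prod_(a <- s) g a, \prod_(a <- s) h a).
  by elim: s => [|a s ih]; rewrite ?big_nil // !big_cons ih.
rewrite !pairE (@retract_respects n c d _ _ ww'); congr pair.
have comm_prod (N : monoidType) (g : letter n (used_span d) -> N) :
    (forall a b : N, a * b = b * a) -> \prod_(a <- w) g a = \prod_(a <- w') g a.
  move=> mC; case: ww' => *; rewrite !big_cons !big_nil !mulg1 //.
  - by congr (_ * _); apply: mC.
  - by rewrite !mulgA; congr (_ * _); apply: mC.
case: c cd => [s|[y x]] cd /=; first by apply: comm_prod; exact: addnC.
by rewrite !pairE (arc_respects cd ww') comm_prod //; exact: GRing.addrC.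
Qed.

Fixpoint kappa (n : nat) (d : diagram) : chinese_monoid n -> (C n (used_span d) * Sfac d)%type :=
  match d with
  | [::] => fun w => (w, 1)
  | c :: d' => fun w =>
      let: (a, s) := @kappa n d' w in
      let: (b, t) := @psi n d' c a in (b, (t, s))
  end.

Lemma kappa_morphism (n : nat) (d : diagram) :
  D n d -> monoid_morphism (@kappa n d).
Proof.
elim: d => [|c d ih] /=; first by split=> // x y; rewrite -[in LHS](mulg1 1).
case/andP=> /ih[k1 kM] /psi_morphism[[p1 pM] _]; split=> [|x y].
  by rewrite k1 /= p1.
rewrite kM; case: (kappa d x) => a s; case: (kappa d y) => b t /=.
by rewrite pM; case: (psi c a) => ? ?; case: (psi c b).
Qed.

Definition rho (n : nat) (d : diagram) : chinese_monoid n -> chinese_monoid n -> Prop :=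
  fun s t => kappa d s = kappa d t.
Arguments rho n d s t : clear implicits.

Definition cong_ideal (K : fieldType) (n : nat)
    (eta : chinese_monoid n -> chinese_monoid n -> Prop)
    (x : {malg K[chinese_monoid n]}) : Prop :=
  exists r : seq (K * (chinese_monoid n * chinese_monoid n)),
    (forall t, t \in r -> eta t.2.1 t.2.2) /\
    x = (\sum_(t <- r) t.1 *: (<< t.2.1 >> - << t.2.2 >>))%R.

(* Main.v *)
Require Import Defs.
From mathcomp Require Import all_boot all_order all_algebra.
From mathcomp Require Import monalg.
From mathcomp Require Import zify.
From mathcomp Require Import boolp.
(* The imports above shadow Dot. *)
Import Defs.

Set Implicit Arguments.
Unset Strict Implicit.
Unset Printing Implicit Defensive.

Local Open Scope quotient_scope.
Local Open Scope group_scope.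

(* An inclusion of the ideals gives an inclusion of the congruences, so a pair
   in rho(d) outside rho(d') is needed.  Let c be the last common vertex of the
   branches of d and d', and e, e' the components added to it in the two
   branches.  For suitable a < b, the homomorphism beta : M -> B, a_l |-> p
   for l <= a, a_l |-> q for l >= b and a_l |-> 1 otherwise factors through
   M / rho(d'): take an arc a_b a_a of d', or a + 1 and b - 1 the ends of the
   used interval of d'.  Going down from e' along the dots that follow it, one
   finds such a, b for which the letters used in c are mapped to 1 and the
   monomial of e is not.  If e is an arc a_y a_x, this monomial is central
   modulo rho(e), but beta maps (a_y a_x) a_i and a_i (a_y a_x) to different
   elements for i = 1 or i = n.  If e is a dot a_s, the same happens with
   a_Y a_s a_i a_X and a_Y a_i a_s a_X, where a_Y a_X is the last arc of c:
   these factors q and p hide the order of a_s and a_i from all arcs of c,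
   since q(qp)p = q(pq)p = 1, and beta maps them to 1. *)

(** * From inclusions of ideals to inclusions of congruences *)

Lemma mmap_scale_sub (K : fieldType) (M : choiceType) (h : M -> K) c x y :
  mmap idfun h (c *: (<< x >> - << y >>))%R = (c * (h x - h y))%R.
Proof.
have scaleU m : (c *: << m >> = << c *g m >> :> {malg K[M]})%R.
  by apply/malgP => k; rewrite mcoeffZ !mcoeffU GRing.mulrnAr GRing.mulr1.
by rewrite GRing.scalerBr !scaleU mmapB !mmapU GRing.mulrBr.
Qed.

(** The indicator function of the [eta]-class of [s], extended linearly to the monoid algebra, kills
    every generator of the ideal; at [s - t] it is 1 unless [eta s t]. *)
Lemma cong_ideal_rel (K : fieldType) n eta (s t : chinese_monoid n) :
  (forall x y, eta x y -> eta s x <-> eta s y) -> eta s s ->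
  @cong_ideal K n eta (<< s >> - << t >>)%R -> eta s t.
Proof.
move=> etaC etass [r [r_eta e]].
pose h m : K := (`[< eta s m >]%:R)%R.
have : (1 * (h s - h t))%R = 0%R.
  rewrite -mmap_scale_sub GRing.scale1r e GRing.raddf_sum big1_seq //.
  move=> [c [x y]] /andP[_ /r_eta /= xy]; rewrite mmap_scale_sub /h.
  by have /asbool_equiv_eq -> := etaC _ _ xy; rewrite GRing.subrr GRing.mulr0.
rewrite /h (introT (asboolP _) etass); case: asboolP => // _ /eqP.
by rewrite GRing.mul1r GRing.subr0 GRing.oner_eq0.
Qed.

(** * Branches, steps and used intervals in the tree *)

Lemma branch_split (T : eqType) (d d' : seq T) :
  ~~ suffix d d' -> ~~ suffix d' d ->
  exists c e e' pre pre',
    [/\ d = pre ++ e :: c, d' = pre' ++ e' :: c & e != e'].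
Proof.
(* The root end of a list of components is its right end, so the common part is stripped from
   there. *)
elim/last_ind: d d' => [|d x ih] d'; first by rewrite suffix0s.
elim/last_ind: d' => [|d' x' _]; first by rewrite suffix0s.
rewrite !suffix_rcons; have [<-|xx'] := eqVneq x x'.
  move=> /= /ih h /h [c [e [e' [pre [pre' [-> -> ee']]]]]].
  by exists (rcons c x), e, e', pre, pre'; rewrite !rcons_cat !rcons_cons.
by move=> _ _; exists [::], x, x', d, d'; rewrite !cats1.
Qed.

Lemma D_cat n pre d : D n (pre ++ d) -> D n d.
Proof. by elim: pre => //= c pre ih /andP[/ih]. Qed.

Lemma used_span_dot s d u v : used_span d = Some (u, v) ->
  used_span (Dot s :: d) = Some (minn s u, maxn s v).
Proof.
rewrite /used_span /used /=; case: (flatten _) => // i w [<- <-].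
rewrite foldr_minn foldr_maxn; congr (Some (_, _)); elim: w => /= [|j w]; lia.
Qed.

Lemma used_span_arc y x d u v : used_span d = Some (u, v) ->
  used_span (Arc y x :: d) = Some (minn x (minn y u), maxn x (maxn y v)).
Proof.
rewrite /used_span /used /=; case: (flatten _) => // i w [<- <-].
rewrite !foldr_minn !foldr_maxn; congr (Some (_, _)); elim: w => /= [|j w]; lia.
Qed.

Lemma used_span_None d : used_span d = None -> d = [::].
Proof. by rewrite /used_span; case: d => [|[s|[y x]] d]. Qed.

Inductive steps_spec n : diagram -> component -> Prop :=
| RootDot s of 2 <= s < n : steps_spec n [::] (Dot s)
| RootArc s of 2 <= s <= n : steps_spec n [::] (Arc s s.-1)
| StepArc d u v of used_span d = Some (u, v) & ~~ is_leaf n d :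
    steps_spec n d (Arc v.+1 u.-1)
| StepDotR b d u v of used_span (b :: d) = Some (u, v)
    & ~~ is_leaf n (b :: d) & v.+1 < n
    & is_arc b || (d != [::]) && (b == Dot v) :
    steps_spec n (b :: d) (Dot v.+1)
| StepDotL b d u v of used_span (b :: d) = Some (u, v)
    & ~~ is_leaf n (b :: d) & 1 < u.-1
    & is_arc b || (d != [::]) && (b == Dot u) :
    steps_spec n (b :: d) (Dot u.-1).

Lemma stepsP n d c : c \in steps n d -> steps_spec n d c.
Proof.
rewrite /steps; case e: (used_span d) => [[u v]|]; last first.
  rewrite (used_span_None e) mem_cat => /orP[] /mapP[s]; rewrite mem_index_iota.
    by move=> h ->; apply: RootDot; lia.
  by move=> h ->; apply: RootArc; lia.
case: ifPn => // nl; rewrite inE => /orP[/eqP ->|]; first exact: StepArc.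
case: d e nl => [|[s|[y x]] d] // e nl.
  case: d e nl => [|b d] // e nl.
  rewrite mem_cat => /orP[]; case: eqP => // sE; case: ifP => // h;
    rewrite inE => /eqP ->.
    by apply: StepDotR e nl h _; rewrite /= sE eqxx.
  by apply: StepDotL e nl h _; rewrite /= sE eqxx.
rewrite mem_cat => /orP[]; case: ifP => // h; rewrite inE => /eqP ->.
  exact: StepDotR e nl h _.
exact: StepDotL e nl h _.
Qed.

(** Dots never sit at 1 or [n], so an interval reaching 1 or [n] does so through an arc, which makes
    the vertex a leaf. *)
Lemma D_bounds n d u v : D n d -> used_span d = Some (u, v) ->
  [/\ 0 < u, u <= v, v <= n & ~~ is_leaf n d -> 1 < u /\ v < n].
Proof.
move=> Dd e; have uv := used_span_le e.
elim: d u v Dd e uv => // c d ih u v /= /andP[Dd /stepsP cd] e uv.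
have leaf0 : ~~ is_leaf n (c :: d) -> ~~ is_leaf n d.
  by rewrite /is_leaf /= negb_or => /andP[].
case: cd Dd ih leaf0 e =>
  [s h|s h|{}d u' v' e nl|b {}d u' v' e nl h _|b {}d u' v' e nl h _] Dd ih l0.
- by case=> <- <-; split; try move=> _; lia.
- case=> <- <-; split; try lia.
  by rewrite /is_leaf /= orbF !inE => h'; split; lia.
- rewrite (used_span_arc _ _ e) => -[eu ev].
  have [h1 h2 h3 /(_ nl) h4] := ih _ _ Dd e (used_span_le e).
  split; try lia; rewrite /is_leaf /= !inE; lia.
- rewrite (used_span_dot _ e) => -[eu ev].
  have [h1 h2 h3 /(_ nl) h4] := ih _ _ Dd e (used_span_le e).
  split; lia.
- rewrite (used_span_dot _ e) => -[eu ev].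
  have [h1 h2 h3 /(_ nl) h4] := ih _ _ Dd e (used_span_le e).
  split; lia.
Qed.

(** * The map [kappa] computed on words *)

Lemma prod_gen (G : choiceType) (R : seq G -> seq G -> Prop) w :
  \prod_(a <- w) gen R a = \pi_(presented R) w.
Proof. by elim: w => [|a w ih]; rewrite ?big_nil // big_cons ih [_ * _]pmul_pi. Qed.

(** On words, [retract] amounts to erasing the used letters, so the components of [kappa] can be
    read off from this. *)
Definition restrict n J (w : seq (letter n None)) : seq (letter n J) :=
  pmap insub (map val w).

Lemma used_in_letter n J (w : letter n J) : used_in J (val w) = false.
Proof. by case: w => l /= /andP[_ /negbTE]. Qed.

Lemma insub_letter n J (l : letter n None) :
  if used_in J (val l) then insub (val l) = None :> option (letter n J)
  else exists2 l' : letter n J, val l' = val l & insub (val l) = Some l'.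
Proof.
case: ifP => h; first by rewrite insubF ?h ?andbF.
by case: insubP => [l' _ <-|]; [exists l'|case: l h => l /= /andP[-> _] ->].
Qed.

Lemma prod_restrict n J (N : monoidType) (f : nat -> N) (w : seq (letter n None)) :
  (forall l : letter n None, used_in J (val l) -> f (val l) = 1) ->
  \prod_(l <- restrict J w) f (val l) = \prod_(l <- w) f (val l).
Proof.
move=> f1; elim: w => [|l w ih]; first by rewrite !big_nil.
rewrite [RHS]big_cons -ih /restrict /=; have := @insub_letter n J l.
case: ifP => [/f1 -> ->|_ [l' l'E ->]] /=; first by rewrite mul1g.
by rewrite big_cons l'E.
Qed.

Lemma prod_pair (I : Type) (G H : monoidType) (g : I -> G) (h : I -> H) s :
  \prod_(a <- s) ((g a, h a) : (G * H)%type) =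
  (\prod_(a <- s) g a, \prod_(a <- s) h a).
Proof. by elim: s => [|a s ih]; rewrite ?big_nil // !big_cons ih. Qed.

Lemma psi_word n d c z : c \in steps n d ->
  @psi n d c (\pi z) = \prod_(l <- z) @psi_gen n d c l.
Proof.
move=> /psi_morphism[[p1 pM] pg]; elim: z => [|l z ih]; first by rewrite big_nil.
by rewrite big_cons -ih -pg -pM [gen _ l * _]pmul_pi.
Qed.

(** Used intervals only grow, so erasing for [d] and then for [c :: d] is erasing for [c :: d] at
    once. *)
Lemma restrict_retract n d c (w : seq (letter n None)) :
  \prod_(l <- restrict (used_span d) w) retract (used_span (c :: d)) l
  = \pi_(C n (used_span (c :: d))) (restrict (used_span (c :: d)) w).
Proof.
pose f l : C n (used_span (c :: d)) := oapp (gen _) 1 (insub l).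
have fE (l : letter n (used_span d)) :
  retract (used_span (c :: d)) l = f (val l) by [].
rewrite (eq_bigr _ (fun l _ => fE l)) prod_restrict; last first.
  move=> l lJ; rewrite /f; have := @insub_letter n (used_span (c :: d)) l.
  case: ifP => [_ -> //|/negP[]]; have [u [v [-> h]]] := used_span_cons c d.
  by case: (used_span d) lJ h => [[u' v']|] //= h /(_ _ _ erefl); lia.
rewrite -prod_gen /restrict; elim: w => [|l w ih]; first by rewrite !big_nil.
by rewrite big_cons ih /f /=; case: insub => [l'|]; rewrite ?mul1g //= big_cons.
Qed.

Lemma kappa_word1 n d (w : seq (letter n None)) : D n d ->
  (kappa d (\pi w)).1 = \pi_(C n (used_span d)) (restrict (used_span d) w).
Proof.
elim: d => [_|c d ih /andP[/ih{}ih cd]] /=.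
  rewrite /restrict; congr (\pi _); elim: w => //= l w {1}->.
  by rewrite valK.
case: (kappa d _) ih => a s /= ->; rewrite psi_word //.
by rewrite /psi_gen prod_pair /= restrict_retract.
Qed.

Lemma kappa_word2 n d c (w : seq (letter n None)) : D n (c :: d) ->
  (kappa (c :: d) (\pi w)).2 =
  (\prod_(l <- restrict (used_span d) w) (@psi_gen n d c l).2, (kappa d (\pi w)).2).
Proof.
move=> /andP[Dd cd] /=; have := kappa_word1 w Dd; case: (kappa d _) => a s /= ->.
rewrite psi_word //; set z := restrict _ w.
suff -> : \prod_(l <- z) (@psi_gen n d c l).2 = (\prod_(l <- z) @psi_gen n d c l).2.
  by case: (\prod_(_ <- _) _).
by elim: z => [|l z ih]; rewrite ?big_nil // !big_cons ih.
Qed.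

(** * The maps [beta a b] into the bicyclic monoid *)

Definition pb : bicyclic := gen _ pB.
Definition qb : bicyclic := gen _ qB.

Lemma qpb : qb * pb = 1.
Proof.
have := @gen_rel _ (fun u v : seq bool => u = [:: qB; pB] /\ v = [::]).
by move/(_ [:: qB; pB] [::]); rewrite !big_cons !big_nil mulg1; apply.
Qed.

(* p acts on nat as the successor and q as the predecessor. *)
Lemma pqb : pb * qb <> 1.
Proof.
pose act (u : seq bool) m := foldr (fun b k => if b then k.+1 else k.-1) m u.
have congE u v : cong (fun u v => u = [:: qB; pB] /\ v = [::]) u v -> act u =1 act v.
  elim=> {u v} [u v [-> ->]|//|u v _ e m|u v w _ e _ e' m|u u' v v' _ e _ e' m] //.
  - by rewrite e e'.
  - by rewrite /act !foldr_cat -!/(act _ _) e e'.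
(* The predecessor of 0 is 0, so [pb * qb] sends 0 to 1. *)
by rewrite [pb * qb]pmul_pi => /presentedP/congE/(_ 0).
Qed.

Definition beta (a b l : nat) : bicyclic :=
  if l <= a then pb else if b <= l then qb else 1.

Definition visible n d a b := forall w w' : seq (letter n None),
  kappa d (\pi w) = kappa d (\pi w') ->
  \prod_(l <- w) beta a b (val l) = \prod_(l <- w') beta a b (val l).

(** Sending low generators to p and high ones to q respects the relations of [C_{u,v}]: generators
    on one side have equal images, and qp = 1 settles the Chinese relations. Composed with the first
    component of [kappa], this is [beta], as the erased letters go to 1. *)
Lemma visible_span n d u v : D n d -> used_span d = Some (u, v) ->
  visible n d u.-1 v.+1.
Proof.
move=> Dd e w w' ww'; have [u0 uv _ _] := D_bounds Dd e.
have usedE i : used_in (used_span d) i = (u <= i <= v) by rewrite e.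
pose ix (l : letter n (used_span d)) : nat := val l.
pose f (l : letter n (used_span d)) := beta u.-1 v.+1 (ix l).
have resp : respects (@C_rel n (used_span d)) f.
  have qpM x : qb * (pb * x) = x by rewrite mulgA qpb mul1g.
  have fE (l : letter n (used_span d)) :
      ix l < u /\ f l = pb \/ v < ix l /\ f l = qb.
    have := used_in_letter l; rewrite usedE -/(ix l) /f /beta => h.
    have [hl|hl] := ltnP (ix l) u; first by left; rewrite ifT //; lia.
    by right; split; [lia|rewrite ifF ?ifT //; lia].
  move=> z z' []; [move=> i k j|move=> i k j|move=> u' v' i k|move=> u' v' i k];
    rewrite !big_cons !big_nil !mulg1.
  - move=> h; have {}h : ix i <= ix k <= ix j := h.
    by have [[hi ->]|[hi ->]] := fE i; have [[hj ->]|[hj ->]] := fE j;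
      have [[hk ->]|[hk ->]] := fE k; rewrite ?qpM ?qpb ?mulg1 //; lia.
  - move=> h; have {}h : ix i <= ix k <= ix j := h.
    by have [[hi ->]|[hi ->]] := fE i; have [[hj ->]|[hj ->]] := fE j;
      have [[hk ->]|[hk ->]] := fE k; rewrite ?qpM ?qpb ?mulg1 //; lia.
  - move=> e'; have [? ?] : u' = u /\ v' = v by move: e'; rewrite e => -[].
    subst u' v' => h h'; have {}h : ix i < u := h; have {}h' : ix k < u := h'.
    by have [[hi ->]|[hi ->]] := fE i;
      have [[hk ->]|[hk ->]] := fE k => //; lia.
  - move=> e'; have [? ?] : u' = u /\ v' = v by move: e'; rewrite e => -[].
    subst u' v' => h h'; have {}h : v < ix i := h; have {}h' : v < ix k := h'.
    by have [[hi ->]|[hi ->]] := fE i;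
      have [[hk ->]|[hk ->]] := fE k => //; lia.
have fw z : \prod_(l <- z) beta u.-1 v.+1 (val l)
    = lift_hom f (kappa d (\pi_(chinese_monoid n) z)).1.
  rewrite kappa_word1 // lift_hom_pi // /f prod_restrict // => l.
  rewrite usedE /beta => h; rewrite !ifF //; lia.
by rewrite !fw ww'.
Qed.

Lemma arc_span n y x d : D n (Arc y x :: d) ->
  [/\ 0 < x, x < y, y <= n, used_span (Arc y x :: d) = Some (x, y)
    & forall l, used_in (used_span d) l = (x < l < y)].
Proof.
move=> /= /andP[Dd /stepsP]; move e: (Arc y x) => c cd.
case: cd Dd e =>
  [s h|s h|{}d u v e nl|b {}d u v e nl h _|b {}d u v e nl h _] //= Dd [-> ->].
  split; try lia; rewrite /used_span /=; congr (Some (_, _)); lia.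
have [h1 h2 h3 /(_ nl) h4] := D_bounds Dd e.
rewrite (used_span_arc _ _ e) e; split=> [||||l /=]; try lia.
congr (Some (_, _)); lia.
Qed.

(** The letters erased before the arc is added lie strictly between [x] and [y], where [beta x y] is
    1, so the product may run over the whole word. *)
Lemma psi_gen_arc n y x d (w : seq (letter n None)) : D n (Arc y x :: d) ->
  \prod_(l <- restrict (used_span d) w) (@psi_gen n d (Arc y x) l).2
  = (\prod_(l <- w) beta x y (val l),
     \prod_(l <- w) (Posz (val l == x) : Zmul)).
Proof.
move=> Dd; have [x0 xy yn _ J] := arc_span Dd; rewrite /psi_gen /= prod_pair.
congr (_, _); last by rewrite (@prod_restrict n _ Zmul (fun l => Posz (l == x))) //
  => l; rewrite J => h; rewrite (_ : _ == x = false) //; lia.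
rewrite -[RHS](@prod_restrict n (used_span d) _ (beta x y)); last first.
  by move=> l; rewrite J /beta => h; rewrite !ifF //; lia.
have betaE m : (x < m < y) = false -> gen _ (if m <= x then pB else qB) = beta x y m.
  by rewrite /beta => h; case: ifP => // h'; rewrite ifT //; lia.
by apply: eq_bigr => l _; apply: betaE; rewrite -J used_in_letter.
Qed.

Lemma visible_arc n y x d pre : D n (pre ++ Arc y x :: d) ->
  visible n (pre ++ Arc y x :: d) x y.
Proof.
move=> Dd w w' /(congr1 snd); elim: pre Dd => [|c pre ih] Dd.
  by rewrite /= !kappa_word2 // !psi_gen_arc // => -[].
rewrite cat_cons !kappa_word2 // => -[_]; apply: ih.
by case/andP: Dd.
Qed.

(** The factors from dots and the integer factors from arcs only count letters, so among the factors
    in [Sfac d] only the bicyclic ones can detect a rearrangement. *)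
Lemma kappa_perm n d (w w' : seq (letter n None)) : D n d -> perm_eq w w' ->
  (forall pre y x g, d = pre ++ Arc y x :: g ->
    \prod_(l <- w) beta x y (val l) = \prod_(l <- w') beta x y (val l)) ->
  (kappa d (\pi w)).2 = (kappa d (\pi w')).2.
Proof.
move=> Dd ww'; elim: d Dd => [//|c d ih] Dd arcs; rewrite !kappa_word2 //.
congr (_, _); last first.
  by case/andP: Dd => Dd _; apply: ih => // pre y x g e;
    apply: (arcs (c :: pre) y x g); rewrite e.
case: c Dd arcs => [s|[y x]] Dd arcs; last first.
  rewrite !psi_gen_arc // (arcs [::] y x d) //; congr (_, _).
  rewrite -![\prod_(l <- _) (_ : Zmul)]/(\sum_(l <- _) Posz (val l == x))%R.
  exact: perm_big.
rewrite /psi_gen /=.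
have perm_res : perm_eq (restrict (used_span d) w) (restrict (used_span d) w').
  exact/perm_pmap/perm_map.
rewrite -![\prod_(l <- _) _]/(\sum_(l <- _) (val l == s))%N.
exact: perm_big.
Qed.

(** * Finding [a] and [b] along the second branch *)

Lemma beta_low a b l : l <= a -> beta a b l = pb.
Proof. by rewrite /beta => ->. Qed.

Lemma beta_high a b l : a < b -> b <= l -> beta a b l = qb.
Proof. by rewrite /beta => ab bl; rewrite ifF ?ifT //; lia. Qed.

Lemma beta_mid a b l : a < l < b -> beta a b l = 1.
Proof. by rewrite /beta => alb; rewrite !ifF //; lia. Qed.

(** The only child of a single dot [s] at level 1 adds the arc with ends [s - 1] and [s + 1], so the
    same bounds serve whether or not the branch continues. *)
Lemma visible_dot1 n pre s : D n (pre ++ [:: Dot s]) ->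
  visible n (pre ++ [:: Dot s]) s.-1 s.+1.
Proof.
elim/last_ind: pre => [|pre e _] Dd; first exact: visible_span.
rewrite cat_rcons in Dd *.
have /= /andP[_ /stepsP] := D_cat Dd; move Ec: [:: _] => c st.
case: st Ec Dd => [||{}c u v|b {}c u v _ _ _|b {}c u v _ _ _] //.
- move=> e' _ Ec Dd; move: e' Dd; rewrite -Ec => -[<- <-]; exact: visible_arc.
- by move=> + [Eb Ec]; rewrite -Eb -Ec.
- by move=> + [Eb Ec]; rewrite -Eb -Ec.
Qed.

(** After the dot [v + 1] comes nothing or an arc, both giving [b = v + 2], or the dot [v + 2], to
    which the induction applies. *)
Lemma visible_dotR n pre c u v : D n (pre ++ Dot v.+1 :: c) ->
  used_span c = Some (u, v) -> v.+1 < n ->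
  exists b, v.+1 < b <= n /\ visible n (pre ++ Dot v.+1 :: c) u.-1 b.
Proof.
elim/last_ind: pre c v => [|pre e ih] c v Dd ec vn;
  have uv := used_span_le ec;
  have ed : used_span (Dot v.+1 :: c) = Some (u, v.+1)
    by rewrite (used_span_dot _ ec); congr (Some (_, _)); lia.
  by exists v.+2; split; [lia|apply: visible_span].
rewrite cat_rcons in Dd *.
have /= /andP[_ /stepsP] := D_cat Dd; move Ec: (_ :: _) => d st.
case: st Ec Dd => [||{}d u' v' e' nl|b {}d u' v' e' nl h _|b {}d u' v' e' nl h bE] //.
- move=> Ec; move: e'; rewrite -Ec ed => -[<- <-] Dd.
  by exists v.+2; split; [lia|apply: visible_arc].
- move=> Ec; move: e' h; rewrite -Ec ed => -[_ <-] h Dd.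
  by have [b' [h' vis]] := ih _ _ Dd ed h; exists b'; split=> //; lia.
(* A dot on the left would need the dot [v + 1] just added to be the left end [u], against
   [u <= v]. *)
- move=> Ec; move: e' bE; rewrite -Ec ed => -[<- _]; case: Ec => <- _ /=.
  by case/andP=> _ /eqP[]; lia.
Qed.

Lemma visible_dotL n pre c u v : D n (pre ++ Dot u.-1 :: c) ->
  used_span c = Some (u, v) -> 1 < u.-1 ->
  exists a, 0 < a < u.-1 /\ visible n (pre ++ Dot u.-1 :: c) a v.+1.
Proof.
elim/last_ind: pre c u => [|pre e ih] c u Dd ec u1;
  have uv := used_span_le ec;
  have ed : used_span (Dot u.-1 :: c) = Some (u.-1, v)
    by rewrite (used_span_dot _ ec); congr (Some (_, _)); lia.
  by exists u.-2; split; [lia|apply: visible_span].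
rewrite cat_rcons in Dd *.
have /= /andP[_ /stepsP] := D_cat Dd; move Ec: (_ :: _) => d st.
case: st Ec Dd => [||{}d u' v' e' nl|b {}d u' v' e' nl h bE|b {}d u' v' e' nl h _] //.
- move=> Ec; move: e'; rewrite -Ec ed => -[<- <-] Dd.
  by exists u.-2; split; [lia|apply: visible_arc].
- move=> Ec; move: e' bE; rewrite -Ec ed => -[_ <-]; case: Ec => <- _ /=.
  by case/andP=> _ /eqP[]; lia.
- move=> Ec; move: e' h; rewrite -Ec ed => -[<- _] h Dd.
  by have [a [h' vis]] := ih _ _ Dd ed h; exists a; split=> //; lia.
Qed.

(* The monomial of e, a_s or a_y a_x, is central modulo rho(e); the condition
   says that beta a b does not map it to 1. *)
Definition separates a b (e : component) : bool :=
  match e with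
  | inl s => (s <= a) || (b <= s)
  | inr (y, x) => (y < b) && (x <= a) || (a < x) && (b <= y)
  end.

Lemma branch_visible n pre c e e' :
  D n (e :: c) -> D n (pre ++ e' :: c) -> e != e' ->
  exists a b, [/\ 0 < a < b, b <= n, separates a b e,
    forall i, used_in (used_span c) i -> a < i < b
    & visible n (pre ++ e' :: c) a b].
Proof.
move=> /= /andP[Dc /stepsP ce] De'; have /= /andP[_ /stepsP ce'] := D_cat De'.
case: c e' / ce' ce Dc De' => [s h|s h|c u v ec nl|b c u v ec nl h _|b c u v ec nl h _].
- move=> ce _ De' ee'; exists s.-1, s.+1; split=> //; try lia; last exact: visible_dot1.
  move: ce ee'; move Ec: [::] => c ce; case: ce Ec => [t ht|t ht|d u v|//|//] /=.
  + by case: (ltngtP t s) => [||->]; rewrite ?eqxx; lia.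
  + by lia.
  + by move=> + _ Ec; rewrite -Ec.
- move=> ce _ De' ee'; exists s.-1, s; split=> //; try lia; last exact: visible_arc.
  move: ce ee'; move Ec: [::] => c ce; case: ce Ec => [t ht|t ht|d u v|//|//] /=.
  + by lia.
  + by case: (ltngtP t s) => [||->]; rewrite ?eqxx; lia.
  + by move=> + _ Ec; rewrite -Ec.
- move=> ce Dc De' ee'; have [h1 h2 h3 /(_ nl) h4] := D_bounds Dc ec.
  (* Since [e'] is the arc, [e] is a dot at one of its two ends, that is, at [a] or [b]. *)
  exists u.-1, v.+1; split=> //; try lia; last exact: visible_arc.
    move: ce ec ee'; move: (c) => d ce.
    case: ce => [||{}d u' v' ec' _|b {}d u' v' ec' _ _ _|b {}d u' v' ec' _ _ _] //=.
    - by rewrite ec' => -[? ?]; subst u' v'; rewrite eqxx.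
    - by rewrite ec' => -[? ?]; subst u' v'; move=> _; lia.
    - by rewrite ec' => -[? ?]; subst u' v'; move=> _; lia.
  by move=> i; rewrite ec /=; lia.
- move=> ce Dc De' ee'; have [h1 h2 h3 /(_ nl) h4] := D_bounds Dc ec.
  have [b' [hb vis]] := visible_dotR De' ec h.
  (* As [v + 1 < b'], the map sends the upper letter of an arc [e] to 1 and the lower one to p; a
     left dot [e] sits at [a]. *)
  exists u.-1, b'; split=> //; try lia.
    move: ce ec ee'; move: (b :: c) => d ce.
    case: ce => [||{}d u' v' ec' _|b1 {}d u' v' ec' _ _ _|b1 {}d u' v' ec' _ _ _] //=.
    - by rewrite ec' => -[? ?]; subst u' v'; move=> _; lia.
    - by rewrite ec' => -[? ?]; subst u' v'; rewrite eqxx.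
    - by rewrite ec' => -[? ?]; subst u' v'; move=> _; lia.
  by move=> i; rewrite ec /=; lia.
- move=> ce Dc De' ee'; have [h1 h2 h3 /(_ nl) h4] := D_bounds Dc ec.
  have [a [ha vis]] := visible_dotL De' ec h.
  exists a, v.+1; split=> //; try lia.
    move: ce ec ee'; move: (b :: c) => d ce.
    case: ce => [||{}d u' v' ec' _|b1 {}d u' v' ec' _ _ _|b1 {}d u' v' ec' _ _ _] //=.
    - by rewrite ec' => -[? ?]; subst u' v'; move=> _; lia.
    - by rewrite ec' => -[? ?]; subst u' v'; move=> _; lia.
    - by rewrite ec' => -[? ?]; subst u' v'; rewrite eqxx.
  by move=> i; rewrite ec /=; lia.
Qed.

(** * Pairs of words that [rho] identifies and [beta a b] separates *)

Lemma restrict_eq n J (w w' : seq (letter n None)) :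
  [seq l <- w | ~~ used_in J (val l)] = [seq l <- w' | ~~ used_in J (val l)] ->
  restrict J w = restrict J w'.
Proof.
suff filt (z : seq (letter n None)) :
    restrict J z = restrict J [seq l <- z | ~~ used_in J (val l)].
  by move=> e; rewrite filt e -filt.
elim: z => //= l z ih; have := @insub_letter n J l.
case: ifP => _ /=; first by rewrite -ih /restrict /= => ->.
by case=> l' _ E; rewrite /restrict /= E /=; congr (_ :: _).
Qed.

Lemma used_in_cons c d i :
  used_in (used_span d) i -> used_in (used_span (c :: d)) i.
Proof.
have [u [v [-> h]]] := used_span_cons c d.
by case: (used_span d) h => [[u' v']|] //= /(_ _ _ erefl); lia.
Qed.

Lemma used_in_dot s d : used_in (used_span (Dot s :: d)) s.
Proof.
case e: (used_span d) => [[u v]|]; first by rewrite (used_span_dot _ e) /=; lia.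
by rewrite (used_span_None e) /= leqnn.
Qed.

Lemma arc_used n pre y x d : D n (pre ++ Arc y x :: d) ->
  [/\ 0 < x < y, y <= n, used_in (used_span (pre ++ Arc y x :: d)) x
    & used_in (used_span (pre ++ Arc y x :: d)) y].
Proof.
move=> Dd; have [x0 xy yn ea _] := arc_span (D_cat Dd).
suff [ux uy] : used_in (used_span (pre ++ Arc y x :: d)) x /\
               used_in (used_span (pre ++ Arc y x :: d)) y.
  by split=> //; rewrite x0.
elim: pre {Dd} => [|c pre [ihx ihy]]; first by rewrite ea /=; lia.
by split; rewrite cat_cons used_in_cons.
Qed.

Lemma rho_word n d (w w' : seq (letter n None)) : D n d -> perm_eq w w' ->
  [seq l <- w | ~~ used_in (used_span d) (val l)]
  = [seq l <- w' | ~~ used_in (used_span d) (val l)] ->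
  (forall pre y x g, d = pre ++ Arc y x :: g ->
    \prod_(l <- w) beta x y (val l) = \prod_(l <- w') beta x y (val l)) ->
  rho n d (\pi w) (\pi w').
Proof.
move=> Dd ww' /restrict_eq e arcs; rewrite /rho.
rewrite [LHS]surjective_pairing [RHS]surjective_pairing.
by rewrite !kappa_word1 // e (kappa_perm Dd ww' arcs).
Qed.

(** The value of [kappa] at a descendant is computed from its value at [d], so the congruences grow
    down a branch. *)
Lemma rho_cat n pre d x y : rho n d x y -> rho n (pre ++ d) x y.
Proof. by rewrite /rho => e; elim: pre => //= c pre ->. Qed.

Lemma letter_exists n l : 0 < l <= n -> exists L : letter n None, val L = l.
Proof.
by move=> h; have h' : (0 < l <= n) && ~~ used_in None l;
  [rewrite h|exists (exist _ l h')].
Qed.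

(* Y and X consist of the two letters of the last arc of c, and are empty if c
   has no arc. *)
Lemma bracket n s c : D n (Dot s :: c) ->
  exists Y X : seq (letter n None),
    all (fun l => used_in (used_span c) (val l)) (Y ++ X) /\
    forall pre y x g, c = pre ++ Arc y x :: g ->
      \prod_(l <- Y) beta x y (val l) = qb /\ \prod_(l <- X) beta x y (val l) = pb.
Proof.
elim: c s => [|c d ih] s Dd; first by exists [::], [::]; split=> // -[].
have Dcd : D n (c :: d) by case/andP: Dd.
case: c Dd Dcd => [t|[y x]] Dd Dcd.
  have [Y [X [used_YX YX]]] := ih _ Dcd; exists Y, X; split.
    by apply: sub_all used_YX => l; exact: used_in_cons.
  by case=> [//|b pre] y x g [_ e]; exact: YX e.
have [x0 xy yn ea J] := arc_span Dcd.
have [Ly Ey] : exists L : letter n None, val L = y by apply: letter_exists; lia.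
have [Lx Ex] : exists L : letter n None, val L = x by apply: letter_exists; lia.
exists [:: Ly], [:: Lx]; split; first by rewrite ea /= Ey Ex; lia.
case=> [|b pre] y' x' g; first case=> <- <- _.
  by rewrite !big_seq1 Ey Ex (@beta_high _ _ y) ?(@beta_low _ _ x).
(* An arc added earlier is nested inside [Arc y x], so [y] is high and [x] is low for it as well. *)
case=> _ e; have Dg : D n (pre ++ Arc y' x' :: g) by rewrite -e; case/andP: Dcd.
have [h1 h2] := arc_used Dg; rewrite -e !J => h3 h4.
by rewrite !big_seq1 Ey Ex (@beta_high _ _ y) ?(@beta_low _ _ x) //; lia.
Qed.

Lemma arc_pair n y x c a b : D n (Arc y x :: c) -> 0 < a < b -> b <= n ->
  separates a b (Arc y x) ->
  exists w w' : seq (letter n None),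
    rho n (Arc y x :: c) (\pi w) (\pi w') /\
    \prod_(l <- w) beta a b (val l) <> \prod_(l <- w') beta a b (val l).
Proof.
move=> Dc ab bn sep; have [x0 xy yn ea J] := arc_span Dc.
have [Ly Ey] : exists L : letter n None, val L = y by apply: letter_exists; lia.
have [Lx Ex] : exists L : letter n None, val L = x by apply: letter_exists; lia.
(* The map [beta a b] sends the monomial of the arc to p or pp in the first case and to q or qq in
   the second; [i] is chosen to go to the other generator. *)
pose i := if (y < b) && (x <= a) then n else 1%N.
have [Li Ei] : exists L : letter n None, val L = i.
  by apply: letter_exists; rewrite /i; case: ifP; lia.
exists [:: Ly; Lx; Li], [:: Li; Ly; Lx]; split.
  apply: rho_word => //.
  - by rewrite (perm_catC [:: Ly; Lx] [:: Li]).
  - by rewrite ea /= Ey Ex !leqnn (ltnW xy).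
  (* For every arc of the diagram [y] is high and [x] is low, so their product becomes qp = 1 on
     either side of [i]. *)
  - move=> pre y' x' g e; have Dg : D n (pre ++ Arc y' x' :: g) by rewrite -e.
    have [h1 h2] := arc_used Dg; rewrite -e ea /= => h3 h4.
    rewrite !big_cons !big_nil !mulg1 Ey Ex Ei.
    rewrite (@beta_high _ _ y) ?(@beta_low _ _ x); try lia.
    by rewrite qpb mulg1 mulgA qpb mul1g.
rewrite !big_cons !big_nil !mulg1 Ey Ex Ei; case/andP: ab => a0 ab.
move: sep; rewrite /i /=; case: ifP => [/andP[yb xa] _|_ /= /andP[ax bY]].
  rewrite (@beta_low _ _ x) // (@beta_high _ _ n) //.
  have [ya|ay] := leqP y a; last by rewrite beta_mid ?ay // !mul1g qpb; exact: pqb.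
  (* Here ppq = qpp = p, and multiplying by q on the left gives pq = 1. *)
  rewrite beta_low // [qb * _]mulgA qpb mul1g => /(congr1 (fun z => qb * z)) /=.
  by rewrite mulgA qpb mul1g; exact: pqb.
rewrite (@beta_low _ _ 1) // (@beta_high _ _ y) //.
have [bx|xb] := leqP b x; last by rewrite beta_mid ?ax // mul1g mulg1 qpb => /esym/pqb.
rewrite beta_high // qpb mulg1 => /(congr1 (fun z => z * pb)) /= /esym.
by rewrite -!mulgA !qpb mulg1; exact: pqb.
Qed.

Lemma dot_pair n s c a b : D n (Dot s :: c) -> 0 < a < b -> b <= n ->
  (forall i, used_in (used_span c) i -> a < i < b) ->
  separates a b (Dot s) ->
  exists w w' : seq (letter n None),
    rho n (Dot s :: c) (\pi w) (\pi w') /\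
    \prod_(l <- w) beta a b (val l) <> \prod_(l <- w') beta a b (val l).
Proof.
move=> Dc ab bn used_ab sep; have [Y [X [used_YX YX]]] := bracket Dc.
have s0n : 0 < s <= n.
  have := used_in_dot s c; case ec: (used_span _) => [[u v]|] //= h.
  by have [] := D_bounds Dc ec; lia.
(* The letter [i] lies on the side opposite to [s], so that [beta a b] sends one of them to p and
   the other to q. *)
pose i := if b <= s then 1%N else n.
have [Ls Es] : exists L : letter n None, val L = s by exact: letter_exists.
have [Li Ei] : exists L : letter n None, val L = i.
  by apply: letter_exists; rewrite /i; case: ifP; lia.
move: used_YX; rewrite all_cat => /andP[used_Y used_X].
exists (Y ++ [:: Ls; Li] ++ X), (Y ++ [:: Li; Ls] ++ X); split.
  apply: rho_word => //.
  - by rewrite perm_cat2l perm_cat2r (perm_catC [:: Ls] [:: Li]).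
  - rewrite !filter_cat; congr (_ ++ (_ ++ _)).
    by move: (used_span _) (used_in_dot s c) => J sJ; rewrite /= Es sJ.
  - case=> [//|_ pre] y x g [_ e].
    have Dg : D n (pre ++ Arc y x :: g) by rewrite -e; case/andP: Dc.
    (* The arcs of [c] lie strictly between [a] and [b], so [s] and [i] are on opposite sides of
       each of them too. *)
    have [h1 h2] := arc_used Dg; rewrite -e => /used_ab h3 /used_ab h4.
    have [Yq Xp] := YX _ _ _ _ e.
    rewrite !big_cat !big_cons !big_nil /= !mulg1 Yq Xp Es Ei /i.
    move: sep => /=; case: ifP => [bs _|_]; last rewrite orbF => sa.
      by rewrite (@beta_high _ _ s) ?(@beta_low _ _ 1);
        rewrite ?qpb ?mul1g ?qpb -?mulgA ?qpb ?mulg1 ?qpb //; lia.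
    by rewrite (@beta_low _ _ s) ?(@beta_high _ _ n);
      rewrite ?qpb ?mul1g ?qpb -?mulgA ?qpb ?mulg1 ?qpb //; lia.
have prod1 (z : seq (letter n None)) :
    all (fun l => used_in (used_span c) (val l)) z ->
    \prod_(l <- z) beta a b (val l) = 1.
  elim: z => [|l z ih] /=; first by rewrite big_nil.
  by case/andP=> /used_ab h /ih e; rewrite big_cons e beta_mid ?mulg1.
rewrite !big_cat /= (prod1 Y) // (prod1 X) // !big_cons !big_nil !mulg1 !mul1g Es Ei /i.
case/andP: ab => a0 ab.
move: sep => /=; case: ifP => [bs _|_]; last rewrite orbF => sa.
  by rewrite (@beta_high _ _ s) ?(@beta_low _ _ 1) // qpb => /esym; exact: pqb.
by rewrite (@beta_low _ _ s) ?(@beta_high _ _ n) // qpb; exact: pqb.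
Qed.

Theorem lemma2p2p13 (K : fieldType) (n : nat) (d d' : diagram) :
  3 <= n -> D n d -> D n d' -> different_branches d d' ->
  ~ (forall x : {malg K[chinese_monoid n]},
       cong_ideal (rho n d) x -> cong_ideal (rho n d') x).
Proof.
move=> _ Dd Dd' /andP[dd' d'd] sub.
have [c [e [e' [pre [pre' [Ed Ed' ee']]]]]] := branch_split dd' d'd.
rewrite {}Ed {}Ed' {dd' d'd} in Dd Dd' sub.
have De : D n (e :: c) := D_cat Dd.
have [a [b [ab bn sep used_ab vis]]] := branch_visible De Dd' ee'.
have [w [w' [ww' neq]]] : exists w w' : seq (letter n None),
    rho n (e :: c) (\pi w) (\pi w') /\
    \prod_(l <- w) beta a b (val l) <> \prod_(l <- w') beta a b (val l).
  case: e De sep {ee' Dd sub} => [s|[y x]] De sep;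
    first exact: dot_pair De ab bn used_ab sep.
  exact: arc_pair De ab bn sep.
apply/neq/vis; apply: (@cong_ideal_rel K n (rho n (pre' ++ e' :: c))) => [x y xy| |].
- by rewrite /rho xy.
- by [].
(* The pair is identified at [e :: c], hence also at its descendant [d], so the difference of the
   two words is a generator of the smaller ideal. *)
apply: sub; exists [:: (1%R, (\pi w, \pi w'))]; split.
  by move=> t; rewrite inE => /eqP ->; apply: rho_cat.
by rewrite big_seq1 GRing.scale1r.
Qed.
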